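(* Let $d\in\{2,3\}$ and let $A,B$ be complex $d\times d$ matrices. Then the following are equivalent: (1) $A$ and $B$ have identical pseudospectra, i.e. $\|(zI-A)^{-1}\|=\|(zI-B)^{-1}\|$ for all $z\in\mathbb{C}$; (2) $A$ and $B$ are polynomially isometric, i.e. $\|p(A)\|=\|p(B)\|$ for every polynomial $p$ with complex coefficients.
   Context: $\|\cdot\|$ denotes the spectral (operator) norm induced by the Euclidean norm on $\mathbb{C}^d$. By convention, $\|(zI-T)^{-1}\|=\infty$ when $z$ is an eigenvalue of $T$, so that identical pseudospectra in particular forces equal spectra. For a polynomial $p(z)=c_0+c_1z+\cdots+c_mz^m$, $p(T)=c_0I+c_1T+\cdots+c_mT^m$. *)

(* Defs.v *)
From HB Require Import structures.
From mathcomp Require Import all_boot all_order all_algebra.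
From mathcomp Require Import all_classical all_reals.
From mathcomp Require Import ereal.
From mathcomp Require Import complex.
Set Implicit Arguments. Unset Strict Implicit. Unset Printing Implicit Defensive.
Import Order.TTheory GRing.Theory Num.Theory.
Local Open Scope ring_scope.
Local Open Scope classical_set_scope.

Definition vnorm (R : realType) (d : nat) (v : 'cV[R[i]]_d) : R :=
  Num.sqrt (\sum_(k < d) (complex.Re (v k 0) ^+ 2 + complex.Im (v k 0) ^+ 2)).

Definition opnorm (R : realType) (d : nat) (T : 'M[R[i]]_d) : R :=
  sup [set vnorm (T *m v) | v in [set v : 'cV[R[i]]_d | vnorm v <= 1]].

Definition resolvent_norm (R : realType) (d : nat) (T : 'M[R[i]]_d) (z : R[i])
  : \bar R :=
  if (z%:M - T) \in unitmx then (opnorm (invmx (z%:M - T)))%:E else +oo%E.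

Definition peval (R : realType) (d : nat) (p : {poly R[i]}) (T : 'M[R[i]]_d)
  : 'M[R[i]]_d :=
  \sum_(k < size p) p`_k *: T ^+ k.

Definition identical_pseudospectra (R : realType) (d : nat) (A B : 'M[R[i]]_d) :=
  forall z : R[i], resolvent_norm A z = resolvent_norm B z.

Definition polynomially_isometric (R : realType) (d : nat) (A B : 'M[R[i]]_d) :=
  forall p : {poly R[i]}, opnorm (peval p A) = opnorm (peval p B).

(* Main.v *)
(** From polynomial isometry to resolvents: the characteristic polynomial of A
    annihilates both matrices, so (z - A)^-1 and (z - B)^-1 are the same
    polynomial in A and in B.

    Conversely, let A and B have identical pseudospectra. If p(A) = 0, then
    p(z) (z - A)^-1 is locally bounded, hence so is p(z) (z - B)^-1, which forces
    p(B) = 0: the annihilators agree. If a quadratic polynomial annihilates both,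
    every p(A) is a multiple of A - g, and A - g is a multiple of a resolvent,
    except for finitely many g, reached by continuity.

    Otherwise d = 3 and A, B have the same characteristic polynomial. The cubics
    det(t - (z - A)^* (z - A)) and det(t - (z - B)^* (z - B)) in t share the root
    t = 1 / ||(z - A)^-1||^2 and differ by
    t (c (|z|^2 - t) + 2 Re(conj(z) w) + k) with c, w, k independent of z.
    If c <> 0, then t is a quadric in z, which happens only for scalar A. So
    c = w = k = 0, and det(x + u A + conj(u) A^* + y A^* A) is the same for A and
    B, for all x, y, u with y real. This determinant decides the norms of all
    linear fractional expressions M(A) N(A)^-1, and modulo the characteristic
    polynomial a generic quadratic expression in A is of that form. *)
Require Import Defs.
From HB Require Import structures.
From mathcomp Require Import all_boot all_order all_algebra.
From mathcomp Require Import all_classical all_reals.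
From mathcomp Require Import ereal complex.
From mathcomp Require Import ring lra.
Set Implicit Arguments.
Unset Strict Implicit.
Unset Printing Implicit Defensive.
Import Order.TTheory GRing.Theory Num.Theory.
Local Open Scope ring_scope.

(** * Euclidean vector norm and the operator norm it induces *)

Section Norms.
Variable R : realType.
Local Notation C := R[i].
Local Notation "x %:C" := (real_complex R x).
Local Notation cabs := (@Normc.normc R).
Implicit Types (x y z : C) (r s : R).

Definition ctmx m n (M : 'M[C]_(m, n)) : 'M[C]_(n, m) := map_mx conjc M^T.

Lemma cabsE z : `|z| = (cabs z)%:C.
Proof. by rewrite normc_def; case: z. Qed.

Lemma cabs_ge0 z : 0 <= cabs z.
Proof. by case: z => a b; apply: sqrtr_ge0. Qed.

Lemma sqr_cabs z : (cabs z ^+ 2)%:C = z * conjc z.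
Proof. by rewrite rmorphXn/= -cabsE sqr_normc. Qed.

Lemma cabs_eq0 z : (cabs z == 0) = (z == 0).
Proof.
by apply/eqP/eqP => [/Normc.eq0_normc//|->]; rewrite Normc.normc0.
Qed.

Lemma cabs_gt0 z : (0 < cabs z) = (z != 0).
Proof. by rewrite lt_def cabs_ge0 cabs_eq0 andbT. Qed.

Lemma cabs_real r : cabs (r%:C) = `|r|.
Proof. by rewrite /Normc.normc/= expr0n/= addr0 sqrtr_sqr. Qed.

Lemma cabs_sqr_sum z : cabs z ^+ 2 = complex.Re z ^+ 2 + complex.Im z ^+ 2.
Proof. by case: z => a b /=; rewrite sqr_sqrtr// addr_ge0 ?sqr_ge0. Qed.

Lemma vnormE n (v : 'cV[C]_n) : vnorm v = Num.sqrt (\sum_k cabs (v k 0) ^+ 2).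
Proof. by congr Num.sqrt; apply: eq_bigr => k _; rewrite cabs_sqr_sum. Qed.

Lemma vnorm_ge0 n (v : 'cV[C]_n) : 0 <= vnorm v.
Proof. exact: sqrtr_ge0. Qed.

Lemma sqr_vnorm n (v : 'cV[C]_n) : vnorm v ^+ 2 = \sum_k cabs (v k 0) ^+ 2.
Proof. by rewrite vnormE sqr_sqrtr// sumr_ge0 => // k _; rewrite sqr_ge0. Qed.

Lemma vnorm_form n (v : 'cV[C]_n) : (vnorm v ^+ 2)%:C = (ctmx v *m v) 0 0.
Proof.
rewrite sqr_vnorm rmorph_sum !mxE; apply: eq_bigr => k _ /=.
by rewrite sqr_cabs !mxE mulrC.
Qed.

Lemma vnorm_eq0 n (v : 'cV[C]_n) : (vnorm v == 0) = (v == 0).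
Proof.
apply/eqP/eqP => [v0|->]; last first.
  by rewrite vnormE big1 ?sqrtr0// => k _; rewrite mxE Normc.normc0 expr0n.
have : \sum_k cabs (v k 0) ^+ 2 == 0 by rewrite -sqr_vnorm v0 expr0n.
rewrite psumr_eq0 => [|k _]; last exact: sqr_ge0.
move/allP => h; apply/matrixP => k j; rewrite ord1 mxE.
have := h k (mem_index_enum k).
by rewrite sqrf_eq0 cabs_eq0 => /eqP.
Qed.

Lemma vnorm0 n : vnorm (0 : 'cV[C]_n) = 0.
Proof. by apply/eqP; rewrite vnorm_eq0. Qed.

Lemma vnorm_gt0 n (v : 'cV[C]_n) : (0 < vnorm v) = (v != 0).
Proof. by rewrite lt_def vnorm_ge0 vnorm_eq0 andbT. Qed.

Lemma vnormZ n z (v : 'cV[C]_n) : vnorm (z *: v) = cabs z * vnorm v.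
Proof.
rewrite !vnormE -(ger0_norm (cabs_ge0 z)) -sqrtr_sqr -sqrtrM ?sqr_ge0//.
congr Num.sqrt; rewrite mulr_sumr; apply: eq_bigr => k _.
by rewrite mxE Normc.normcM exprMn.
Qed.

(** The sum of the squares [(a k - t * b k) ^+ 2] is a quadratic in [t] that is never negative; a
    suitable [t] gives the bound. *)
Lemma cauchy_schwarz n (a b : 'I_n -> R) :
  \sum_k a k * b k <=
  Num.sqrt (\sum_k a k ^+ 2) * Num.sqrt (\sum_k b k ^+ 2).
Proof.
set X := \sum_k a k ^+ 2; set Y := \sum_k b k ^+ 2; set Z := \sum_k a k * b k.
have X0 : 0 <= X by apply: sumr_ge0 => k _; rewrite sqr_ge0.
have Y0 : 0 <= Y by apply: sumr_ge0 => k _; rewrite sqr_ge0.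
have quad t : 0 <= X - t * Z *+ 2 + t ^+ 2 * Y.
  have -> : X - t * Z *+ 2 + t ^+ 2 * Y = \sum_k (a k - t * b k) ^+ 2.
    rewrite /X /Y /Z !mulr_sumr -sumrMnl -sumrB -big_split/=.
    by apply: eq_bigr => k _; ring.
  by apply: sumr_ge0 => k _; rewrite sqr_ge0.
have [Zle0|Zgt0] := leP Z 0.
  by rewrite (le_trans Zle0)// mulr_ge0 ?sqrtr_ge0.
rewrite -sqrtrM// -(ger0_norm (ltW Zgt0)) -sqrtr_sqr ler_sqrt ?mulr_ge0//.
have [Y0'|Yne0] := eqVneq Y 0.
  (* With [Y = 0] the quadratic is affine in [t], and this [t] gives it the value -1. *)
  have := quad ((X + 1) / (2 * Z)).
  rewrite Y0' mulr0 addr0 mulrC -mulrnAl => h.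
  have E : (Z *+ 2) * ((X + 1) / (2 * Z)) = X + 1.
    by field; rewrite gt_eqF.
  by move: h; rewrite mulrnAl -mulrnAl E => h; exfalso; lra.
have Yp : 0 < Y by rewrite lt_def Yne0 Y0.
(* The minimiser of the quadratic. *)
have := quad (Z / Y).
have -> : X - Z / Y * Z *+ 2 + (Z / Y) ^+ 2 * Y = (X * Y - Z ^+ 2) / Y.
  by field.
by rewrite pmulr_lge0 ?invr_gt0// subr_ge0.
Qed.

Lemma vnormD n (u v : 'cV[C]_n) : vnorm (u + v) <= vnorm u + vnorm v.
Proof.
rewrite -(ler_pXn2r (ltn0Sn 1)) ?nnegrE ?addr_ge0 ?vnorm_ge0//.
have := @cauchy_schwarz n (fun k => cabs (u k 0)) (fun k => cabs (v k 0)).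
rewrite -!vnormE sqrrD !sqr_vnorm => cs.
apply: (@le_trans _ _ (\sum_k (cabs (u k 0) + cabs (v k 0)) ^+ 2)).
  apply: ler_sum => k _; rewrite mxE ler_pXn2r// ?nnegrE ?addr_ge0 ?cabs_ge0//.
  exact: le_normcD.
under eq_bigr do rewrite sqrrD.
rewrite !big_split/= lerD2r lerD2l mulr2n.
exact: lerD.
Qed.

Lemma vnorm_sum n (I : finType) (F : I -> 'cV[C]_n) :
  vnorm (\sum_i F i) <= \sum_i vnorm (F i).
Proof.
elim/big_rec2: _ => [|i y x _ le_xy]; first by rewrite le_eqVlt vnorm_eq0 eqxx.
by apply: le_trans (vnormD _ _) _; rewrite lerD2l.
Qed.

Lemma cabs_le_vnorm n (v : 'cV[C]_n) k : cabs (v k 0) <= vnorm v.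
Proof.
rewrite -(ler_pXn2r (ltn0Sn 1)) ?nnegrE ?cabs_ge0 ?vnorm_ge0//.
rewrite sqr_vnorm (bigD1 k)//= lerDl; apply: sumr_ge0 => j _.
exact: sqr_ge0.
Qed.

Section Operator.
Variable n : nat.
Implicit Types (S T : 'M[C]_n) (v : 'cV[C]_n).

Let unit_ball T : set R :=
  [set vnorm (T *m v) | v in [set v : 'cV[C]_n | vnorm v <= 1]]%classic.

(** Boundedness makes the [sup] in [opnorm] a genuine least upper bound. Entries of a vector in the
    unit ball have modulus at most 1, so the sum of the column norms is a bound. *)
Lemma opnorm_has_ubound T : has_ubound (unit_ball T).
Proof.
exists (\sum_j vnorm (col j T)) => _ [v /= v1 <-].
have -> : T *m v = \sum_j v j 0 *: col j T.
  apply/matrixP => i k; rewrite ord1 mxE summxE.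
  by apply: eq_bigr => j _; rewrite !mxE mulrC.
apply: le_trans (vnorm_sum _) _; apply: ler_sum => j _.
rewrite vnormZ -[leRHS]mul1r ler_wpM2r ?vnorm_ge0//.
exact: le_trans (cabs_le_vnorm _ _) v1.
Qed.

Lemma unit_ball0 T : unit_ball T 0.
Proof.
exists 0; last by rewrite mulmx0 vnorm0.
by rewrite /= vnorm0 ler01.
Qed.

Lemma opnorm_ge0 T : 0 <= opnorm T.
Proof. by apply: ub_le_sup (unit_ball0 T); apply: opnorm_has_ubound. Qed.

Lemma vnorm_mul_le T v : vnorm (T *m v) <= opnorm T * vnorm v.
Proof.
have [->|v0] := eqVneq v 0.
  by rewrite mulmx0 vnorm0 mulr0.
have vp : 0 < vnorm v by rewrite vnorm_gt0.
rewrite -ler_pdivrMr// mulrC.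
have E w : vnorm (((vnorm v)^-1)%:C *: w) = (vnorm v)^-1 * vnorm w.
  by rewrite vnormZ cabs_real ger0_norm ?invr_ge0 ?vnorm_ge0.
rewrite -E scalemxAr; apply: ub_le_sup; first exact: opnorm_has_ubound.
by exists (((vnorm v)^-1)%:C *: v) => //=; rewrite E mulVf ?gt_eqF.
Qed.

Lemma opnorm_le T r : 0 <= r -> (forall v, vnorm (T *m v) <= r * vnorm v) ->
  opnorm T <= r.
Proof.
move=> r0 h; apply: ge_sup => [|_ [v /= v1 <-]].
  by exists 0; apply: unit_ball0.
by apply: le_trans (h v) _; rewrite -[leRHS]mulr1 ler_wpM2l.
Qed.

Lemma opnorm_eq0 T : (opnorm T == 0) = (T == 0).
Proof.
apply/eqP/eqP => [T0|->]; last first.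
  apply/eqP; rewrite eq_le opnorm_ge0 andbT.
  by apply: opnorm_le => // v; rewrite mul0mx mul0r le_eqVlt vnorm_eq0 eqxx.
apply/matrixP => i j; rewrite mxE.
have : T *m delta_mx j 0 == 0 :> 'cV_n.
  rewrite -vnorm_eq0 eq_le vnorm_ge0 andbT.
  by have := vnorm_mul_le T (delta_mx j 0); rewrite T0 mul0r.
by rewrite -colE => /eqP/matrixP/(_ i 0); rewrite !mxE.
Qed.

Lemma opnormD S T : opnorm (S + T) <= opnorm S + opnorm T.
Proof.
apply: opnorm_le => [|v]; first by rewrite addr_ge0 ?opnorm_ge0.
rewrite mulmxDl mulrDl; apply: le_trans (vnormD _ _) _.
by rewrite lerD ?vnorm_mul_le.
Qed.

Lemma opnormM S T : opnorm (S *m T) <= opnorm S * opnorm T.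
Proof.
apply: opnorm_le => [|v]; first by rewrite mulr_ge0 ?opnorm_ge0.
rewrite -mulmxA; apply: le_trans (vnorm_mul_le _ _) _.
by rewrite -mulrA ler_wpM2l ?opnorm_ge0 ?vnorm_mul_le.
Qed.

Lemma opnormZ z T : opnorm (z *: T) = cabs z * opnorm T.
Proof.
have le w S : opnorm (w *: S) <= cabs w * opnorm S.
  apply: opnorm_le => [|v]; first by rewrite mulr_ge0 ?opnorm_ge0 ?cabs_ge0.
  by rewrite -scalemxAl vnormZ -mulrA ler_wpM2l ?cabs_ge0 ?vnorm_mul_le.
apply/eqP; rewrite eq_le le/=.
have [->|z0] := eqVneq z 0; first by rewrite Normc.normc0 mul0r opnorm_ge0.
have zp : 0 < cabs z by rewrite cabs_gt0.
(* The reverse inequality is the first one for the scalar [z^-1] and the matrix [z *: T]. *)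
rewrite -ler_pdivlMl// -Normc.normcV; apply: le_trans (le _ _).
by rewrite scalerA (mulVf z0) scale1r.
Qed.

Lemma opnormN T : opnorm (- T) = opnorm T.
Proof. by rewrite -scaleN1r opnormZ normcN Normc.normc1 mul1r. Qed.

Lemma opnormB S T : opnorm (S - T) <= opnorm S + opnorm T.
Proof. by rewrite -(opnormN T); apply: opnormD. Qed.

End Operator.
End Norms.

(** * Conjugate transposes, and operator norms as roots of determinants *)

Section Adjoint.
Variable R : realType.
Local Notation C := R[i].
Local Notation "x %:C" := (real_complex R x).

Lemma ctmxM m n p (M : 'M[C]_(m, n)) (N : 'M[C]_(n, p)) :
  ctmx (M *m N) = ctmx N *m ctmx M.
Proof. by rewrite /ctmx trmx_mul map_mxM. Qed.

Lemma ctmxK m n (M : 'M[C]_(m, n)) : ctmx (ctmx M) = M.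
Proof. by apply/matrixP => i j; rewrite !mxE conjcK. Qed.

Lemma ctmxD m n (M N : 'M[C]_(m, n)) : ctmx (M + N) = ctmx M + ctmx N.
Proof. by rewrite /ctmx linearD/= map_mxD. Qed.

Lemma ctmxB m n (M N : 'M[C]_(m, n)) : ctmx (M - N) = ctmx M - ctmx N.
Proof. by rewrite /ctmx linearB/= map_mxB. Qed.

Lemma ctmxZ m n z (M : 'M[C]_(m, n)) : ctmx (z *: M) = conjc z *: ctmx M.
Proof. by rewrite /ctmx linearZ/= map_mxZ. Qed.

Lemma ctmx_scalar n z : ctmx (z%:M : 'M[C]_n) = (conjc z)%:M.
Proof. by rewrite /ctmx tr_scalar_mx map_scalar_mx. Qed.

Lemma det_ctmx n (M : 'M[C]_n) : \det (ctmx M) = conjc (\det M).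
Proof. by rewrite det_map_mx det_tr. Qed.

Lemma mxtrace_ctmx n (M : 'M[C]_n) : \tr (ctmx M) = conjc (\tr M).
Proof. by rewrite /mxtrace rmorph_sum; apply: eq_bigr => i _; rewrite !mxE. Qed.

Lemma form_sub_sqr n (T : 'M[C]_n) (v : 'cV[C]_n) (s : R) :
  (s ^+ 2 * vnorm v ^+ 2 - vnorm (T *m v) ^+ 2)%:C =
  (ctmx v *m (((s ^+ 2)%:C)%:M - ctmx T *m T) *m v) 0 0.
Proof.
rewrite rmorphB rmorphM /= !vnorm_form mulmxBr mulmxBl ctmxM !mulmxA.
rewrite mul_mx_scalar -scalemxAl.
by move: (ctmx v *m v) (ctmx v *m _ *m _ *m v) => X Y; rewrite !mxE.
Qed.

Lemma hermitian_sub_sqr n (T : 'M[C]_n) (s : R) :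
  ctmx (((s ^+ 2)%:C)%:M - ctmx T *m T) = ((s ^+ 2)%:C)%:M - ctmx T *m T.
Proof. by rewrite ctmxB ctmxM ctmxK ctmx_scalar conjc_real. Qed.

(* Expanding the nonnegative form of P = s^2 - T^* T at v - e P v, with
   e = 1 / (s^2 + 1), bounds <P v, v> from below by e |P v|^2. *)
Lemma psd_form_lower_bound n (T : 'M[C]_n) (v : 'cV[C]_n) :
  vnorm ((((opnorm T ^+ 2)%:C)%:M - ctmx T *m T) *m v) ^+ 2 <=
  (opnorm T ^+ 2 + 1) * (opnorm T ^+ 2 * vnorm v ^+ 2 - vnorm (T *m v) ^+ 2).
Proof.
set s := opnorm T; pose P := ((s ^+ 2)%:C)%:M - ctmx T *m T; rewrite -/P.
pose g (u : 'cV[C]_n) := s ^+ 2 * vnorm u ^+ 2 - vnorm (T *m u) ^+ 2.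
have g0 u : 0 <= g u.
  rewrite subr_ge0 -exprMn ler_pXn2r ?nnegrE ?mulr_ge0 ?vnorm_ge0 ?opnorm_ge0//.
  exact: vnorm_mul_le.
have gE u : (g u)%:C = (ctmx u *m P *m u) 0 0 by apply: form_sub_sqr.
pose w := P *m v; pose e := (s ^+ 2 + 1)^-1.
have sp : 0 < s ^+ 2 + 1 by rewrite ltr_wpDl ?sqr_ge0.
have gw : g w <= s ^+ 2 * vnorm w ^+ 2 by rewrite gerBl sqr_ge0.
have gv : g v = s ^+ 2 * vnorm v ^+ 2 - vnorm (T *m v) ^+ 2 by [].
rewrite -{}gv; clearbody g.
have gexp : g (v - e%:C *: w) = g v - 2 * e * vnorm w ^+ 2 + e ^+ 2 * g w.
  apply: (@complexI R); have := vnorm_form w.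
  move: (vnorm w ^+ 2) => W WE; rewrite !(rmorphD, rmorphN, rmorphM)/= !gE WE.
  have PvE : ctmx v *m P = ctmx w by rewrite /w ctmxM hermitian_sub_sqr.
  rewrite ctmxB ctmxZ conjc_real mulmxBl PvE -scalemxAl mulmxBr !mulmxBl.
  rewrite -!scalemxAr -!scalemxAl -[ctmx w *m P *m v]mulmxA -/w.
  move: (ctmx w *m w) (ctmx w *m v) (ctmx w *m P *m w) => X Y Z.
  by rewrite !mxE rmorph1; ring.
have h := g0 (v - e%:C *: w); rewrite gexp in h.
have e0 : 0 < e by rewrite invr_gt0.
have h2 : e * vnorm w ^+ 2 <= g v.
  (* Since [e * s ^+ 2 <= 1], the second-order term cancels at most half of the first-order term
     [2 * e * vnorm w ^+ 2]. *)
  have : e ^+ 2 * g w <= e * vnorm w ^+ 2.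
    rewrite expr2 -mulrA ler_pM2l// /e mulrC ler_pdivrMr// [leRHS]mulrC.
    by apply: le_trans gw _; rewrite ler_wpM2r ?sqr_ge0// lerDl.
  lra.
by rewrite -ler_pdivrMl.
Qed.

Lemma det0_colP n (M : 'M[C]_n) :
  \det M = 0 -> exists2 v : 'cV[C]_n, v != 0 & M *m v = 0.
Proof.
move=> dM; have /det0P[v v0 vM] : \det M^T == 0 by rewrite det_tr dM.
exists v^T; first by rewrite trmx_eq0.
by rewrite -[M]trmxK -trmx_mul vM trmx0.
Qed.

(** The squared norm is an eigenvalue of [T^* T]. Otherwise [P = s^2 - T^* T] has a bounded inverse,
    and the lower bound on its form improves [|T v|^2 <= s^2 |v|^2] by a fixed [c > 0], against the
    choice of [s] as a supremum. *)
Lemma opnorm_det n (T : 'M[C]_n.+1) :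
  \det ((((opnorm T) ^+ 2)%:C)%:M - ctmx T *m T) = 0.
Proof.
set s := opnorm T; set P := (X in \det X); apply/eqP/negPn/negP => dP.
have uP : P \in unitmx by rewrite unitmxE unitfE.
have [k kp hk] : exists2 k, 0 < k & opnorm (invmx P) ^+ 2 <= k.
  by exists (opnorm (invmx P) ^+ 2 + 1); rewrite ?lerDl// ltr_wpDl ?sqr_ge0.
have sp : 0 < s ^+ 2 + 1 by rewrite ltr_wpDl ?sqr_ge0.
have [c cE] : exists c, c = (k * (s ^+ 2 + 1))^-1 by eexists.
have cp : 0 < c by rewrite cE invr_gt0 mulr_gt0.
have bound (v : 'cV[C]_n.+1) : vnorm (T *m v) ^+ 2 <= (s ^+ 2 - c) * vnorm v ^+ 2.
  have h := psd_form_lower_bound T v; rewrite -/s -/P in h.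
  have : vnorm v ^+ 2 <= k * vnorm (P *m v) ^+ 2.
    rewrite -{1}(mulKmx uP v).
    apply: (@le_trans _ _ ((opnorm (invmx P) * vnorm (P *m v)) ^+ 2)).
      by rewrite ler_pXn2r ?nnegrE ?mulr_ge0 ?vnorm_ge0 ?opnorm_ge0// vnorm_mul_le.
    by rewrite exprMn ler_wpM2r ?sqr_ge0.
  move=> /le_trans/(_ (ler_wpM2l (ltW kp) h)).
  rewrite mulrA -ler_pdivrMl ?mulr_gt0// -cE => {}h.
  by rewrite mulrBl; lra.
have [sc|sc] := leP 0 (s ^+ 2 - c).
  have : s <= Num.sqrt (s ^+ 2 - c).
    rewrite /s; apply: opnorm_le => [|v]; first exact: sqrtr_ge0.
    rewrite -(ler_pXn2r (ltn0Sn 1)) ?nnegrE ?mulr_ge0 ?vnorm_ge0 ?sqrtr_ge0//.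
    by rewrite exprMn (sqr_sqrtr sc) bound.
  rewrite -(ler_pXn2r (ltn0Sn 1)) ?nnegrE ?opnorm_ge0 ?sqrtr_ge0//.
  by rewrite (sqr_sqrtr sc); lra.
(* If [s ^+ 2 - c < 0], the improved bound fails at any nonzero vector. *)
pose v : 'cV[C]_n.+1 := delta_mx 0 0.
have v0 : v != 0.
  apply/eqP => /matrixP/(_ 0 0); rewrite !mxE !eqxx/=.
  by move/eqP; rewrite oner_eq0.
have := bound v; apply/negP; rewrite -ltNge.
by apply: lt_le_trans (sqr_ge0 _); rewrite nmulr_rlt0// exprn_gt0// vnorm_gt0.
Qed.

Lemma opnorm_frac_det n (M N : 'M[C]_n.+1) : N \in unitmx ->
  \det (((opnorm (M *m invmx N)) ^+ 2)%:C *: (ctmx N *m N) - ctmx M *m M) = 0.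
Proof.
move=> uN; set T := M *m invmx N.
have -> : M = T *m N by rewrite mulmxKV.
have -> : ((opnorm T) ^+ 2)%:C *: (ctmx N *m N) - ctmx (T *m N) *m (T *m N) =
    ctmx N *m (((opnorm T) ^+ 2)%:C%:M - ctmx T *m T) *m N.
  rewrite mulmxBr mulmxBl ctmxM !mulmxA; congr (_ - _).
  by rewrite mul_mx_scalar -scalemxAl.
by rewrite !det_mulmx opnorm_det mulr0 mul0r.
Qed.

(** A kernel vector [v] satisfies [s |N v| = |M v|], so [N v] is stretched by the factor [s]. *)
Lemma opnorm_frac_ge n (M N : 'M[C]_n) (s : R) : N \in unitmx -> 0 <= s ->
  \det ((s ^+ 2)%:C *: (ctmx N *m N) - ctmx M *m M) = 0 ->
  s <= opnorm (M *m invmx N).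
Proof.
move=> uN s0 /det0_colP[v v0 Pv].
have E : (s ^+ 2)%:C *: (ctmx (N *m v) *m (N *m v)) = ctmx (M *m v) *m (M *m v).
  have := congr1 (mulmx (ctmx v)) Pv.
  rewrite mulmx0 mulmxBl mulmxBr -scalemxAl -scalemxAr => /eqP.
  by rewrite subr_eq0 !ctmxM !mulmxA => /eqP.
have : s ^+ 2 * vnorm (N *m v) ^+ 2 = vnorm (M *m v) ^+ 2.
  apply: (@complexI R); rewrite [LHS](rmorphM (real_complex R))/= !vnorm_form -E.
  by rewrite [RHS]mxE.
have Nv0 : 0 < vnorm (N *m v).
  rewrite vnorm_gt0; apply: contra v0 => /eqP Nv.
  by rewrite -(mulKmx uN v) Nv mulmx0.
rewrite -exprMn => /eqP; rewrite eqrXn2 ?mulr_ge0 ?vnorm_ge0// => /eqP E2.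
rewrite -(ler_pM2r Nv0) E2; have := vnorm_mul_le (M *m invmx N) (N *m v).
by rewrite mulmxA mulmxKV.
Qed.

(** The norm of [M N^-1] is the largest nonnegative root [s] of the determinant, so the determinant
    as a function of [s] decides it. *)
Lemma opnorm_frac_eq n (M N M' N' : 'M[C]_n.+1) :
  N \in unitmx -> N' \in unitmx ->
  (forall s : R, \det ((s ^+ 2)%:C *: (ctmx N *m N) - ctmx M *m M) =
                 \det ((s ^+ 2)%:C *: (ctmx N' *m N') - ctmx M' *m M')) ->
  opnorm (M *m invmx N) = opnorm (M' *m invmx N').
Proof.
move=> uN uN' E; apply/eqP; rewrite eq_le; apply/andP; split.
  by apply: opnorm_frac_ge; rewrite ?opnorm_ge0// -E opnorm_frac_det.
by apply: opnorm_frac_ge; rewrite ?opnorm_ge0// E opnorm_frac_det.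
Qed.

End Adjoint.

(** * Bounds on resolvents and annihilating polynomials *)

Section Resolvents.
Variable R : realType.
Local Notation C := R[i].
Local Notation "x %:C" := (real_complex R x).
Local Notation cabs := (@Normc.normc R).

(** Among [size p] distinct values one is not a root. Applied to characteristic polynomials, this
    picks points off the spectrum. *)
Lemma exists_nonroot (p : {poly C}) (f : nat -> C) :
  p != 0 -> injective f -> exists k, ~~ root p (f k).
Proof.
move=> p0 injf; apply: contrapT => /forallNP all_roots.
have /(max_poly_roots p0)/(_ _) : all (root p) (map f (iota 0 (size p))).
  by apply/allP => _ /mapP[k _ ->]; apply/negPn/negP/all_roots.
by rewrite map_inj_uniq// iota_uniq size_map size_iota ltnn => /(_ isT).
Qed.

Lemma exists_nonroot_near (p : {poly C}) (a : C) (e : R) :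
  p != 0 -> 0 < e -> exists z, [/\ cabs (z - a) < e, z != a & ~~ root p z].
Proof.
(* The shift by two keeps the distance to [a] strictly below [e] even for [k = 0]. *)
move=> p0 e0; pose f k := a + (e / k.+2%:R)%:C.
have fp k : 0 < e / k.+2%:R by rewrite divr_gt0 ?ltr0Sn.
have injf : injective f.
  move=> j k /addrI /complexI /(mulfI (lt0r_neq0 e0)) /invr_inj /eqP.
  by rewrite eqr_nat => /eqP[].
have [k nr] := exists_nonroot p0 injf; exists (f k); split=> //.
  rewrite /f addrAC subrr add0r cabs_real ger0_norm ?ltW//.
  by rewrite ltr_pdivrMr ?ltr0Sn// ltr_pMr// ltr1n.
by rewrite /f -subr_eq0 addrAC subrr add0r -cabs_eq0 cabs_real normr_eq0 gt_eqF.
Qed.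

Variable n : nat.
Implicit Types (A B T M : 'M[C]_n.+1) (z : C).

Lemma pevalE T p : peval p T = horner_mx T p.
Proof.
rewrite /peval -[in RHS](coefK p) poly_def rmorph_sum/=; apply: eq_bigr => k _.
by rewrite linearZ/= rmorphXn/= horner_mx_X.
Qed.

Lemma horner_char_poly T z : (char_poly T).[z] = \det (z%:M - T).
Proof.
rewrite /char_poly /char_poly_mx -[_.[z]]/(horner_eval z _) -det_map_mx; congr (\det _).
apply/matrixP => i j; rewrite !mxE/= /horner_eval hornerD hornerN hornerC.
by case: eqP => _; rewrite ?mulr1n ?mulr0n ?hornerX ?hornerC.
Qed.

Lemma char_poly_neq0 T : char_poly T != 0.
Proof. exact: monic_neq0 (char_poly_monic T). Qed.

Lemma unit_resolvent T z :
  (z%:M - T \in unitmx) = ~~ root (char_poly T) z.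
Proof. by rewrite unitmxE unitfE rootE horner_char_poly. Qed.

Lemma horner_bounded (p : {poly C}) (r : R) :
  exists K, forall z, cabs z <= r -> cabs p.[z] <= K.
Proof.
elim/poly_ind: p => [|p c [K hK]].
  by exists 0 => z _; rewrite horner0 Normc.normc0.
exists (K * r + cabs c) => z zr; rewrite hornerMXaddC.
apply: le_trans (le_normcD _ _) _; rewrite lerD2r Normc.normcM.
by apply: ler_pM => //; rewrite ?cabs_ge0 ?hK.
Qed.

(** [H] is the divided difference [(p(z) - p(X)) / (z - X)] taken at [X = T]. It is polynomial in
    [z], hence bounded on discs. *)
Lemma horner_quotient_bounded T (p : {poly C}) (r : R) :
  exists K, forall z, cabs z <= r -> exists2 H : 'M[C]_n.+1,
    (z%:M - T) *m H = p.[z]%:M - horner_mx T p & opnorm H <= K.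
Proof.
elim/poly_ind: p => [|p c [K hK]].
  exists 0 => z _; exists 0; last by rewrite le_eqVlt opnorm_eq0 eqxx.
  by rewrite mulmx0 horner0 (rmorph0 (horner_mx T)) subr0 raddf0.
have [K' hK'] := horner_bounded p r.
exists (K' * opnorm (1%:M : 'M[C]_n.+1) + opnorm T * K) => z zr.
(* The Horner recursion for the divided difference of [p * 'X + c]. *)
have [H HE HK] := hK z zr; exists (p.[z]%:M + T *m H).
  have -> : horner_mx T (p * 'X + c%:P) = T *m horner_mx T p + c%:M.
    rewrite rmorphD rmorphM/= horner_mx_X horner_mx_C; congr (_ + _).
    exact: (comm_horner_mx p (erefl (T *m T))).
  have comm : (z%:M - T) *m T = T *m (z%:M - T).
    by rewrite mulmxBl mulmxBr scalar_mxC.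
  rewrite hornerMXaddC mulmxDr mulmxA comm -mulmxA HE mulmxBl mulmxBr.
  rewrite -scalar_mxM (mulrC z) addrA subrK.
  have -> : (p.[z] * z + c)%:M = (p.[z] * z)%:M + c%:M :> 'M[C]_n.+1.
    by rewrite raddfD.
  by rewrite opprD addrACA subrr addr0.
apply: le_trans (opnormD _ _) _; apply: lerD.
  by rewrite -scalemx1 opnormZ ler_wpM2r ?opnorm_ge0 ?hK'.
apply: le_trans (opnormM _ _) _.
by rewrite ler_wpM2l ?opnorm_ge0.
Qed.

Lemma mulmx_inv_comm M T : T \in unitmx -> M *m T = T *m M ->
  M *m invmx T = invmx T *m M.
Proof.
move=> uT MT; rewrite -[in RHS](mulmxK uT M) MT.
by rewrite -!mulmxA mulKmx.
Qed.

(* If M (z - T)^-1 is bounded near the spectrum, then peeling off one root a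
   of the characteristic polynomial at a time reduces to M (T - a) = 0, where
   M (z - T)^-1 = M / (z - a) is bounded only for M = 0. *)
Lemma bounded_resolvent_eq0 T M :
  (forall r, exists K, forall z, cabs z <= r -> z%:M - T \in unitmx ->
    opnorm (M *m invmx (z%:M - T)) <= K) ->
  M = 0.
Proof.
have [rs rsE] := closed_field_poly_normal (char_poly T).
move: rsE; rewrite (monicP (char_poly_monic T)) scale1r => rsE.
have : M *m horner_mx T (\prod_(a <- rs) ('X - a%:P)) = 0.
  by rewrite -rsE Cayley_Hamilton mulmx0.
move: {rsE} rs M; elim=> [|a rs IH] M.
  by rewrite big_nil rmorph1 mulmx1.
rewrite big_cons rmorphM/= rmorphB/= horner_mx_X horner_mx_C mulmxA => M0 bM.
have comm z : z%:M - T \in unitmx ->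
    (T - a%:M) *m invmx (z%:M - T) = invmx (z%:M - T) *m (T - a%:M).
  move=> uz; apply: mulmx_inv_comm uz _.
  have -> : T - a%:M = (z - a)%:M - (z%:M - T).
    by rewrite raddfB/= opprB [RHS]addrC addrA subrK.
  by move: (z%:M - T) => X; rewrite mulmxBl mulmxBr scalar_mxC.
have Ma : M *m (T - a%:M) = 0.
  apply: IH M0 _ => r; have [K hK] := bM r.
  exists (K * opnorm (T - a%:M)) => z zr uz.
  rewrite -mulmxA comm// mulmxA; apply: le_trans (opnormM _ _) _.
  by rewrite ler_wpM2r ?opnorm_ge0 ?hK.
apply/eqP; rewrite -opnorm_eq0 eq_le opnorm_ge0 andbT; apply/ler_addgt0Pl => e e0.
rewrite addr0.
have [K hK] := bM (cabs a + 1).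
(* At distance less than [d] from [a], the norm of [M = (z - a) M (z - T)^-1] is at most [d * K];
   [d <= 1] keeps [z] in the disc on which [K] is a bound. *)
have [d [d0 d1 dK]] : exists d, [/\ 0 < d, d <= 1 & d * K <= e].
  exists (Num.min 1 (e / (`|K| + 1))).
  have Kp : 0 < `|K| + 1 by rewrite ltr_wpDl.
  rewrite lt_min ltr01 divr_gt0// ge_min lexx; split=> //.
  apply: (@le_trans _ _ (e / (`|K| + 1) * (`|K| + 1))); last by rewrite divfK ?gt_eqF.
  apply: (@le_trans _ _ (Num.min 1 (e / (`|K| + 1)) * (`|K| + 1))).
    apply: ler_wpM2l; first by rewrite le_min ler01 divr_ge0// ltW.
    by apply/ltW; rewrite ltr_pwDr// ler_norm.
  by apply: ler_wpM2r; [apply: ltW | rewrite ge_min lexx orbT].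
have [z [za zna nr]] := exists_nonroot_near a (char_poly_neq0 T) d0.
have uz : z%:M - T \in unitmx by rewrite unit_resolvent.
have zr : cabs z <= cabs a + 1.
  rewrite -{1}(subrK a z); apply: le_trans (le_normcD _ _) _.
  by rewrite addrC lerD2l (le_trans (ltW za)).
have E : M = (z - a) *: (M *m invmx (z%:M - T)).
  rewrite scalemxAl -[LHS](mulmxK uz); congr (_ *m _).
  have -> : z%:M - T = (z - a)%:M - (T - a%:M).
    by rewrite raddfB/= opprB addrA subrK.
  by rewrite mulmxBr Ma subr0 mul_mx_scalar.
rewrite E opnormZ; apply: le_trans dK.
by apply: ler_pM; rewrite ?cabs_ge0 ?opnorm_ge0 ?hK// ltW.
Qed.

Lemma identical_unit A B z : identical_pseudospectra A B ->
  (z%:M - A \in unitmx) = (z%:M - B \in unitmx).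
Proof.
move=> /(_ z); rewrite /resolvent_norm.
move: (opnorm (invmx (z%:M - A))) (opnorm (invmx (z%:M - B))) => x y.
by case: (z%:M - A \in unitmx); case: (z%:M - B \in unitmx).
Qed.

Lemma identical_norm A B z : identical_pseudospectra A B ->
  z%:M - A \in unitmx -> opnorm (invmx (z%:M - A)) = opnorm (invmx (z%:M - B)).
Proof.
move=> AB uA; have uB := uA; rewrite (identical_unit z AB) in uB.
move: (AB z); rewrite /resolvent_norm uA uB.
by move: (opnorm (invmx (z%:M - A))) (opnorm (invmx (z%:M - B))) => x y [].
Qed.

(** For [T = A, B], the matrices [p(z) (z - T)^-1] and [p(T) (z - T)^-1] differ by a bounded divided
    difference. For [A] the second is zero, so the first is bounded; its norm is the same for
    [B]. *)
Lemma identical_annihilator A B (p : {poly C}) : identical_pseudospectra A B ->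
  horner_mx A p = 0 -> horner_mx B p = 0.
Proof.
move=> AB pA; apply: (@bounded_resolvent_eq0 B) => r.
have [KA hA] := horner_quotient_bounded A p r.
have [KB hB] := horner_quotient_bounded B p r.
exists (KA + KB) => z zr uB.
have uA : z%:M - A \in unitmx by rewrite (identical_unit z AB).
have [HA HAE HAK] := hA z zr; have [HB HBE HBK] := hB z zr.
have EA : p.[z] *: invmx (z%:M - A) = HA.
  by rewrite -(mulKmx uA HA) HAE pA subr0 mul_mx_scalar.
have -> : horner_mx B p *m invmx (z%:M - B) = p.[z] *: invmx (z%:M - B) - HB.
  rewrite mulmx_inv_comm//; last first.
    rewrite mulmxBl mulmxBr scalar_mxC; congr (_ - _).
    by rewrite (comm_mx_horner p (erefl (B *m B))).
  by rewrite -[in RHS](mulKmx uB HB) HBE mulmxBr mul_mx_scalar opprB [RHS]addrC subrK.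
apply: le_trans (opnormB _ _) _; apply: lerD; last exact: HBK.
by rewrite opnormZ -(identical_norm AB)// -opnormZ EA.
Qed.

End Resolvents.

(** * From polynomial isometry to pseudospectra, and the converse under a quadratic annihilator *)

Lemma poly_size3E (F : fieldType) (p : {poly F}) : (size p <= 3)%N ->
  p = p`_2 *: 'X^2 + p`_1 *: 'X + (p`_0)%:P.
Proof.
move=> p3; apply/polyP => i; rewrite !coefD !coefZ coefXn coefX coefC.
case: i => [|[|[|i]]]/=; rewrite ?mulr0 ?mulr1 ?addr0 ?add0r//.
by rewrite nth_default // (leq_trans p3).
Qed.

Section Quadratic.
Variable R : realType.
Local Notation C := R[i].
Local Notation cabs := (@Normc.normc R).
#[local] Opaque opnorm vnorm.
Variable n : nat.
Implicit Types (A B S T : 'M[C]_n.+1) (z : C) (p q f : {poly C}).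

Lemma opnorm_scalar_le z : opnorm (z%:M : 'M[C]_n.+1) <= cabs z.
Proof.
by apply: opnorm_le => [|v]; rewrite ?cabs_ge0// mul_scalar_mx vnormZ.
Qed.

(** The continuity step that reaches the finitely many parameters at which a resolvent does not
    exist. *)
Lemma opnorm_le_approx S T :
  (forall e : R, 0 < e -> exists S' T', [/\ opnorm (S - S') <= e,
     opnorm (T' - T) <= e & opnorm S' <= opnorm T']) ->
  opnorm S <= opnorm T.
Proof.
move=> h; apply/ler_addgt0Pr => e e0.
have [|S' [T' [hS hT hST]]] := h (e / 2); first by rewrite divr_gt0.
have := opnormD (S - S') S'; rewrite subrK => h1.
have := opnormD (T' - T) T; rewrite subrK => h2.
move: (opnorm S) (opnorm T) (opnorm S') (opnorm T') (opnorm (S - S')) (opnorm (T' - T))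
  h1 h2 hS hT hST => *; lra.
Qed.

(** Dividing [p - p(z)] by ['X - z] gives [q] up to the factor [p(z)]. It is chosen before [T], so
    the same [q] serves both matrices. *)
Lemma resolvent_polynomial p z : p.[z] != 0 -> exists q, forall T,
  horner_mx T p = 0 ->
  z%:M - T \in unitmx /\ invmx (z%:M - T) = horner_mx T q.
Proof.
move=> pz.
have /factor_theorem[q qE] : root (p - p.[z]%:P) z.
  by rewrite rootE !hornerE subrr.
exists (p.[z]^-1 *: q) => T pT.
have E : horner_mx T (p.[z]^-1 *: q) *m (z%:M - T) = 1%:M.
  have := congr1 (horner_mx T) qE.
  rewrite rmorphM !rmorphB/= pT horner_mx_X !horner_mx_C sub0r => /esym qT.
  rewrite linearZ/= -scalemxAl -[z%:M - T]opprB mulmxN [_ *m _]qT opprK.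
  by rewrite scale_scalar_mx mulVf.
have [_ uT] := mulmx1_unit E; split=> //.
by rewrite -[RHS](mulmxK uT) E mul1mx.
Qed.

Lemma polynomially_isometric_sym A B :
  polynomially_isometric A B -> polynomially_isometric B A.
Proof. by move=> AB x; apply: esym (AB x). Qed.

Lemma identical_pseudospectra_sym A B :
  identical_pseudospectra A B -> identical_pseudospectra B A.
Proof. by move=> AB x; apply: esym (AB x). Qed.

Lemma polynomially_isometric_annihilator A B p :
  polynomially_isometric A B -> horner_mx A p = 0 -> horner_mx B p = 0.
Proof.
move=> AB /eqP; rewrite -opnorm_eq0 -pevalE AB pevalE opnorm_eq0.
by move/eqP.
Qed.

Lemma polynomially_isometric_resolvent A B z : polynomially_isometric A B ->
  z%:M - A \in unitmx -> resolvent_norm A z = resolvent_norm B z.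
Proof.
move=> AB uA; have pz : (char_poly A).[z] != 0.
  by rewrite horner_char_poly -unitfE -unitmxE.
have [q hq] := resolvent_polynomial pz.
have [_ EA] := hq A (Cayley_Hamilton A).
have [uB EB] := hq B (polynomially_isometric_annihilator AB (Cayley_Hamilton A)).
rewrite /resolvent_norm uA uB EA EB -!pevalE.
exact: congr1 (AB q).
Qed.

Lemma polynomially_isometric_identical A B :
  polynomially_isometric A B -> identical_pseudospectra A B.
Proof.
move=> AB z; case uA : (z%:M - A \in unitmx).
  exact: polynomially_isometric_resolvent.
case uB : (z%:M - B \in unitmx).
  apply/esym.
  exact: polynomially_isometric_resolvent (polynomially_isometric_sym AB) uB.
by rewrite /resolvent_norm uA uB.
Qed.

(* Modulo a monic quadratic p = X^2 + p1 X + p0, the factor T - g is p(g) times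
   the resolvent of T at the point - p1 - g. *)
Lemma quadratic_shift_le A B p (g : C) : identical_pseudospectra A B ->
  p \is monic -> size p = 3 -> horner_mx A p = 0 -> horner_mx B p = 0 ->
  opnorm (A - g%:M) <= opnorm (B - g%:M).
Proof.
move=> AB pmon p3 pA pB.
have pE : p = 'X * 'X + (p`_1)%:P * 'X + (p`_0)%:P.
  have p2 : p`_2 = 1 by move/monicP: pmon; rewrite /lead_coef p3.
  rewrite {1}(poly_size3E (eq_leq p3)) p2 scale1r -mul_polyC.
  by rewrite expr2.
pose g' z := - p`_1 - z.
have fact T z : horner_mx T p = 0 -> (T - z%:M) *m ((g' z)%:M - T) = p.[z]%:M.
  move=> pT.
  have polE : ('X - z%:P) * ((g' z)%:P - 'X) = p.[z]%:P - p.
    rewrite {2}pE {1}pE !hornerE /g'; rewrite !(rmorphD, rmorphN, rmorphM)/=.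
    ring.
  have := congr1 (horner_mx T) polE.
  by rewrite rmorphM !rmorphB/= pT horner_mx_X !horner_mx_C subr0.
have shift T z : horner_mx T p = 0 -> p.[z] != 0 ->
    (g' z)%:M - T \in unitmx /\ T - z%:M = p.[z] *: invmx ((g' z)%:M - T).
  move=> pT pz; have E := fact T z pT.
  have uT : (g' z)%:M - T \in unitmx.
    suff : (p.[z]^-1 *: (T - z%:M)) *m ((g' z)%:M - T) = 1%:M.
      by case/mulmx1_unit.
    by rewrite -scalemxAl E scale_scalar_mx mulVf.
  by split=> //; rewrite -[LHS](mulmxK uT) E mul_scalar_mx.
apply: opnorm_le_approx => e e0.
have [z [zg _ pz]] := exists_nonroot_near g (monic_neq0 pmon) e0.
have [uA EA] := shift A z pA pz; have [uB EB] := shift B z pB pz.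
exists (A - z%:M), (B - z%:M); split.
- rewrite opprB addrC addrA subrK -raddfB/=.
  by apply: le_trans (opnorm_scalar_le _) _; rewrite ltW.
- rewrite opprB addrC addrA subrK -raddfB/= -opprB raddfN.
  by rewrite opnormN; apply: le_trans (opnorm_scalar_le _) _; rewrite ltW.
by rewrite EA EB !opnormZ (identical_norm AB).
Qed.

Lemma quadratic_isometric_le A B p f : identical_pseudospectra A B ->
  p \is monic -> size p = 3 -> horner_mx A p = 0 -> horner_mx B p = 0 ->
  opnorm (horner_mx A f) <= opnorm (horner_mx B f).
Proof.
move=> AB pmon p3 pA pB; pose r := f %% p.
have redE (T : 'M[C]_n.+1) : horner_mx T p = 0 -> horner_mx T f = r`_1 *: T + (r`_0)%:M.
  move=> pT; rewrite {1}(divp_eq f p) rmorphD rmorphM/= pT mulr0 add0r.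
  have r2 : (size r <= 2)%N by have := ltn_modpN0 f (monic_neq0 pmon); rewrite p3.
  rewrite -/r {1}(poly_size3E (leqW r2)) (nth_default _ r2) scale0r add0r.
  by rewrite rmorphD/= linearZ/= horner_mx_X horner_mx_C.
rewrite (redE A pA) (redE B pB).
(* For a constant remainder both sides are the norm of the same scalar matrix. *)
have [->|r1] := eqVneq r`_1 0; first by rewrite !scale0r.
have E T : r`_1 *: T + (r`_0)%:M = r`_1 *: (T - (- (r`_0 / r`_1))%:M).
  by rewrite raddfN/= opprK scalerDr scale_scalar_mx mulrC divfK.
rewrite !E !opnormZ; apply: ler_wpM2l; first exact: cabs_ge0.
exact: quadratic_shift_le AB pmon p3 pA pB.
Qed.

Lemma quadratic_isometric A B p : identical_pseudospectra A B ->
  p != 0 -> (size p <= 3)%N -> horner_mx A p = 0 -> polynomially_isometric A B.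
Proof.
move=> AB p0 p3 pA f; rewrite !pevalE.
(* Normalises [p] and pads it with a power of ['X] to degree exactly two. *)
pose q := (lead_coef p)^-1 *: (p * 'X^(3 - size p)).
have lp0 : lead_coef p != 0 by rewrite lead_coef_eq0.
have qmon : q \is monic.
  by apply/monicP; rewrite lead_coefZ (lead_coef_Mmonic _ (monicXn _ _)) mulVf.
have q3 : size q = 3.
  by rewrite size_scale ?invr_eq0// size_mulXn// subnK.
have qA : horner_mx A q = 0.
  by rewrite linearZ/= rmorphM/= pA mul0r scaler0.
have qB := identical_annihilator AB qA.
apply/eqP; rewrite eq_le; apply/andP; split.
  exact: quadratic_isometric_le AB qmon q3 qA qB.
exact: quadratic_isometric_le (identical_pseudospectra_sym AB) qmon q3 qB qA.
Qed.

End Quadratic.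

(** * Determinants of [t - (z - T)^* (z - T)], computed through traces *)

Section GramDeterminants.
Variable R : realType.
Local Notation C := R[i].
Local Notation "x %:C" := (real_complex R x).
#[local] Opaque opnorm vnorm.

(** Doubling avoids the division by 2 that expresses the second elementary symmetric function of the
    eigenvalues by traces. *)
Lemma det3_sub_scalar (F : comNzRingType) (H : 'M[F]_3) (t : F) :
  2 * \det (t%:M - H) = 2 * t ^+ 3 - 2 * \tr H * t ^+ 2
    + ((\tr H) ^+ 2 - \tr (H *m H)) * t - 2 * \det H.
Proof.
have det3 (M : 'M[F]_3) : let m i j := M (inord i) (inord j) in
    \det M = m 0 0 * (m 1 1 * m 2 2 - m 1 2 * m 2 1)
           - m 0 1 * (m 1 0 * m 2 2 - m 1 2 * m 2 0)
           + m 0 2 * (m 1 0 * m 2 1 - m 1 1 * m 2 0).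
  move=> m; have mE i j : M i j = m i j by rewrite /m !inord_val.
  rewrite (expand_det_row _ ord0) !big_ord_recl big_ord0 /cofactor.
  rewrite !(expand_det_row _ ord0) !big_ord_recl !big_ord0 /cofactor !det_mx11.
  rewrite !mxE !mE /=.
  rewrite /bump /=; ring.
rewrite !det3 /= /mxtrace !big_ord_recl !big_ord0 !mxE !big_ord_recl !big_ord0.
pose h i j := H (inord i) (inord j).
have hE i j : H i j = h i j by rewrite /h !inord_val.
rewrite !hE -!val_eqE /= !inordK //= /bump /=; ring.
Qed.

(** [H] has the shape of the expansion [gramE], with [X = T], [Y = T^*] and [G = T^* T]. *)
Lemma mxtrace_sqr4 n (u x y : C) (X Y G : 'M[C]_n) :
  let H := u%:M + x *: X + y *: Y + G in
  \tr (H *m H) = n%:R * u ^+ 2 + x ^+ 2 * \tr (X *m X) + y ^+ 2 * \tr (Y *m Y)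
    + \tr (G *m G) + 2 * (u * x * \tr X + u * y * \tr Y + u * \tr G
    + x * y * \tr (X *m Y) + x * \tr (X *m G) + y * \tr (Y *m G)).
Proof.
move=> H; rewrite /H !mulmxDl !mulmxDr -scalar_mxM.
rewrite !mul_mx_scalar !mul_scalar_mx -!scalemxAl -!scalemxAr.
rewrite !mxtraceD !mxtraceZ mxtrace_scalar (mxtrace_mulC Y X).
by rewrite (mxtrace_mulC G X) (mxtrace_mulC G Y) -mulr_natl; ring.
Qed.

Definition gram n (T : 'M[C]_n) (z : C) : 'M[C]_n :=
  ctmx (z%:M - T) *m (z%:M - T).

Lemma gramE n (T : 'M[C]_n) z : gram T z =
  (z * conjc z)%:M + (- conjc z) *: T + (- z) *: ctmx T + ctmx T *m T.
Proof.
rewrite /gram ctmxB ctmx_scalar mulmxBl !mulmxBr -scalar_mxM mul_scalar_mx.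
by rewrite mul_mx_scalar !scaleNr opprB addrA [conjc z * z]mulrC addrAC.
Qed.

Lemma mxtrace_conj_eq n (X Y : 'M[C]_n) : ctmx X = Y -> conjc (\tr X) = \tr Y.
Proof. by move=> <-; rewrite mxtrace_ctmx. Qed.

(** The determinants of the two Gram matrices agree, so the cubics differ only in their [t^2] and
    [t] terms. Once the traces of [T] and [T^2] cancel, these depend on the traces of [T^* T],
    [T T^* T] and [(T^* T)^2]. *)
Lemma det_gram_diff (A B : 'M[C]_3) :
  \tr A = \tr B -> \tr (A *m A) = \tr (B *m B) ->
  (forall z, \det (z%:M - A) = \det (z%:M - B)) ->
  exists c w k : C, [/\ conjc c = c, conjc k = k & forall z t,
    \det (t%:M - gram A z) - \det (t%:M - gram B z) =
    t * (c * (z * conjc z - t) + conjc z * w + z * conjc w + k)].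
Proof.
move=> trE trsqE detE.
pose h (T : 'M[C]_3) := \tr (ctmx T *m T).
pose m (T : 'M[C]_3) := \tr ((ctmx T *m T) *m (ctmx T *m T)).
pose v (T : 'M[C]_3) := \tr (T *m (ctmx T *m T)).
have hJ T : conjc (h T) = h T.
  by apply: mxtrace_conj_eq; rewrite ctmxM ctmxK.
have mJ T : conjc (m T) = m T.
  by apply: mxtrace_conj_eq; rewrite !ctmxM ctmxK.
have vJ (T : 'M[C]_3) : \tr (ctmx T *m (ctmx T *m T)) = conjc (v T).
  rewrite /v -mxtrace_ctmx !ctmxM ctmxK.
  by rewrite -[RHS]mxtrace_mulC.
have trG T z : \tr (gram T z) = 3 * (z * conjc z) - conjc z * \tr T
    - z * conjc (\tr T) + h T.
  rewrite gramE !mxtraceD !mxtraceZ mxtrace_scalar mxtrace_ctmx -mulr_natl.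
  by rewrite /h; ring.
have trGG T z : \tr (gram T z *m gram T z) = 3 * (z * conjc z) ^+ 2
    + (conjc z) ^+ 2 * \tr (T *m T) + z ^+ 2 * conjc (\tr (T *m T)) + m T
    + 2 * (- (z * conjc z) * (conjc z * \tr T + z * conjc (\tr T))
           + 2 * (z * conjc z) * h T - conjc z * v T - z * conjc (v T)).
  rewrite gramE mxtrace_sqr4 -ctmxM !mxtrace_ctmx vJ (mxtrace_mulC T (ctmx T)).
  by rewrite -/(h T) -/(m T) -/(v T); ring.
have detG (T : 'M[C]_3) z : \det (gram T z) =
    conjc (\det (z%:M - T)) * \det (z%:M - T).
  by rewrite /gram det_mulmx det_ctmx.
have [c cE] : exists c, c = h A - h B by exists (h A - h B).
(* [c] is read off the [t^2] term; the other two come from the [t] term, sorted by powers of [z] and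
   its conjugate. *)
exists c, (v A - v B - c * \tr A), ((c * (h A + h B) - (m A - m B)) / 2).
have cJ : conjc c = c by rewrite cE rmorphB/= !hJ.
split=> // [|z t].
  rewrite rmorphM fmorphV rmorph_nat rmorphB rmorphM rmorphB rmorphD/=.
  by rewrite cJ !hJ !mJ.
have two0 : (2 : C) != 0 by rewrite pnatr_eq0.
apply: (mulfI two0); rewrite mulrBr !det3_sub_scalar !detG detE !trG !trGG.
rewrite -trE -trsqE !(rmorphB, rmorphM)/= cJ cE.
by field.
Qed.

Lemma opnorm_inv_gt0 n (N : 'M[C]_n.+1) : N \in unitmx -> 0 < opnorm (invmx N).
Proof.
move=> uN; rewrite lt_def opnorm_ge0 andbT opnorm_eq0; apply/eqP => N0.
have /eqP := mulmxV uN; rewrite N0 mulmx0 eq_sym.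
by rewrite -[1%:M]/(1 : 'M[C]_n.+1) oner_eq0.
Qed.

(** The case [M = 1], [N = z - T] of [opnorm_frac_det], divided by [- s^2]. *)
Lemma resolvent_norm_gram_root n (T : 'M[C]_n.+1) z : z%:M - T \in unitmx ->
  \det (((opnorm (invmx (z%:M - T)) ^- 2)%:C)%:M - gram T z) = 0.
Proof.
move=> uN; have := opnorm_inv_gt0 uN; have := opnorm_frac_det 1%:M uN.
rewrite mul1mx -/(gram T z) ctmx_scalar rmorph1 mul1mx.
move: (opnorm _) => s sdet s0.
have s2 : (s ^+ 2)%:C != 0.
  by rewrite -(rmorph0 (real_complex R)) (inj_eq (@complexI R)) expf_neq0 ?gt_eqF.
have E : (s ^+ 2)%:C *: gram T z - 1%:M =
    (- (s ^+ 2)%:C) *: (((s ^- 2)%:C)%:M - gram T z).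
  rewrite scalerBr scale_scalar_mx fmorphV/= mulNr divff// scaleNr opprK addrC.
  by rewrite raddfN.
move/eqP: sdet; rewrite E detZ mulf_eq0 expf_eq0/= oppr_eq0 (negPf s2)/=.
by move/eqP.
Qed.

End GramDeterminants.

(** * Consequences of the root shared by the two cubics *)

Section Cubic.
Variable R : realType.
Local Notation C := R[i].
Local Notation "x %:C" := (real_complex R x).
Local Notation cabs := (@Normc.normc R).
#[local] Opaque opnorm vnorm.

(** An eigenvector for [mu] is an eigenvector of the resolvent, with eigenvalue [1 / (z - mu)]. *)
Lemma resolvent_norm_ge n (A : 'M[C]_n.+1) (mu z : C) :
  root (char_poly A) mu -> z%:M - A \in unitmx ->
  1 <= cabs (z - mu) * opnorm (invmx (z%:M - A)).
Proof.
rewrite rootE horner_char_poly => /eqP/det0_colP[v v0 Av] uz.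
have vp : 0 < vnorm v by rewrite vnorm_gt0.
have E : v = (z - mu) *: (invmx (z%:M - A) *m v).
  rewrite scalemxAr -[LHS](mulKmx uz); congr (_ *m _).
  have -> : z%:M - A = (z - mu)%:M + (mu%:M - A).
    by rewrite raddfB/= addrA subrK.
  by rewrite mulmxDl Av addr0 mul_scalar_mx.
rewrite -(ler_pM2r vp) mul1r {1}E vnormZ -mulrA.
by apply: ler_wpM2l; [apply: cabs_ge0 | apply: vnorm_mul_le].
Qed.

Lemma real_of_conj (k : C) : conjc k = k -> exists r : R, k = r%:C.
Proof.
case: k => a b [] /eqP; rewrite eq_sym -addr_eq0 -mulr2n mulrn_eq0/= => /eqP->.
by exists a.
Qed.

(* Comparing t = 1 / ||(z - A)^-1||^2 with |z - mu|^2 at an eigenvalue mu, far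
   away from the spectrum and near mu, forces t = |z - mu|^2. *)
Lemma resolvent_norm_quadric_scalar n (A : 'M[C]_n.+1) (w k : C) :
  conjc k = k ->
  (forall z, z%:M - A \in unitmx -> (opnorm (invmx (z%:M - A)) ^- 2)%:C =
    z * conjc z + conjc z * w + z * conjc w + k) ->
  exists mu, A = mu%:M.
Proof.
move=> kJ shape.
have [mu mu_root] : exists mu, root (char_poly A) mu.
  by apply/closed_rootP; rewrite size_char_poly.
exists mu.
have muJ : conjc (k - mu * conjc mu) = k - mu * conjc mu.
  by rewrite rmorphB rmorphM/= conjcK kJ [conjc mu * mu]mulrC.
have [r rE] := real_of_conj muJ.
have t_le z : z%:M - A \in unitmx ->
    opnorm (invmx (z%:M - A)) ^- 2 <= cabs (z - mu) ^+ 2.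
  move=> uz; have := resolvent_norm_ge mu_root uz; have := opnorm_inv_gt0 uz.
  move: (opnorm _) => s s0; rewrite -exprVn mulrC -ler_pdivrMl// mulr1 => h.
  by rewrite ler_pXn2r ?nnegrE ?invr_ge0 ?cabs_ge0// ltW.
have [delta dE] : exists d, d = w + mu by exists (w + mu).
have t_eq z : z%:M - A \in unitmx ->
    (opnorm (invmx (z%:M - A)) ^- 2 - cabs (z - mu) ^+ 2)%:C =
    conjc z * delta + z * conjc delta + r%:C.
  move=> uz; rewrite rmorphB/= shape// sqr_cabs -rE dE rmorphB rmorphD/=.
  by ring.
have d0 : delta = 0.
  apply/eqP/negPn/negP => dn0.
  (* Along [z = x delta] the difference of [t] and [|z - mu|^2] is [2 x |delta|^2 + r]. These [x]
     make it positive, against [t_le]; infinitely many are offered so that one avoids the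
     spectrum. *)
  have [x xE] : exists x : nat -> R,
      forall j, x j = (`|r| + 1) / cabs delta ^+ 2 * j.+1%:R by eexists.
  have dp : 0 < cabs delta by rewrite cabs_gt0.
  have rp : 0 < `|r| + 1 by rewrite ltr_wpDl.
  have injx : injective (fun j => (x j)%:C * delta).
    move=> i j /(mulIf dn0) /complexI; rewrite !xE => /mulfI E.
    have : (i.+1%:R : R) = j.+1%:R by apply: E; rewrite gt_eqF// divr_gt0// exprn_gt0.
    by move/eqP; rewrite eqr_nat => /eqP[].
  have [j nr] := exists_nonroot (char_poly_neq0 A) injx.
  set z := (x j)%:C * delta in nr.
  have uz : z%:M - A \in unitmx by rewrite unit_resolvent.
  have zJ : conjc z = (x j)%:C * conjc delta.
    by rewrite /z rmorphM; congr (_ * _); apply: conjc_real.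
  have zE : conjc z * delta + z * conjc delta + r%:C =
      (2 * (x j * cabs delta ^+ 2) + r)%:C.
    rewrite [RHS](rmorphD (real_complex R)) (rmorphM (real_complex R) 2).
    rewrite (rmorphM (real_complex R) (x j)) rmorph_nat/= sqr_cabs zJ /z.
    by ring.
  have := t_le z uz; have := t_eq z uz; rewrite zE.
  move=> /complexI E; rewrite -subr_le0 E; apply/negP; rewrite -ltNge.
  have -> : x j * cabs delta ^+ 2 = (`|r| + 1) * j.+1%:R.
    by rewrite xE mulrAC divfK// expf_neq0// gt_eqF.
  have : (`|r| + 1) <= (`|r| + 1) * j.+1%:R by rewrite ler_peMr ?ler1n// ltW.
  have := ler_norm (- r); rewrite normrN.
  move: (`|r|) ((`|r| + 1) * _) rp => *; lra.
have {}t_eq z : z%:M - A \in unitmx ->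
    opnorm (invmx (z%:M - A)) ^- 2 = cabs (z - mu) ^+ 2 + r.
  move=> uz; have := t_eq z uz; rewrite d0 rmorph0 !mulr0 !add0r => /complexI <-.
  by rewrite [RHS]addrC subrK.
(* Otherwise [t] is negative at distance less than [sqrt (- r)] from [mu]. *)
have r0 : 0 <= r.
  rewrite leNgt; apply/negP => rneg.
  have sp : 0 < Num.sqrt (- r) by rewrite sqrtr_gt0 oppr_gt0.
  have [z [zmu _ nr]] := exists_nonroot_near mu (char_poly_neq0 A) sp.
  have uz : z%:M - A \in unitmx by rewrite unit_resolvent.
  have : 0 < opnorm (invmx (z%:M - A)) ^- 2.
    by rewrite invr_gt0 exprn_gt0 ?opnorm_inv_gt0.
  rewrite t_eq//; move: zmu.
  rewrite -(ltr_pXn2r (ltn0Sn 1)) ?nnegrE ?cabs_ge0 ?sqrtr_ge0//.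
  rewrite sqr_sqrtr ?oppr_ge0 ?ltW//; move: (cabs _ ^+ 2) => q; lra.
(* Now [t >= |z - mu|^2], so [(z - mu) (z - A)^-1] has norm at most 1, and [(A - mu) (z - A)^-1]
   differs from it by the identity. *)
apply/eqP; rewrite -subr_eq0; apply/eqP/(@bounded_resolvent_eq0 _ _ A) => b.
exists (1 + cabs 1) => z _ uz.
have -> : (A - mu%:M) *m invmx (z%:M - A) = (z - mu) *: invmx (z%:M - A) - 1%:M.
  have -> : A - mu%:M = (z - mu)%:M - (z%:M - A).
    by rewrite raddfB/= opprB [RHS]addrC addrA subrK.
  by rewrite mulmxBl mulmxV// mul_scalar_mx.
apply: le_trans (opnormB _ _) _; apply: lerD; last exact: opnorm_scalar_le.
rewrite opnormZ; have := t_eq z uz; have := opnorm_inv_gt0 uz.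
move: (opnorm _) => s s0 E.
have : cabs (z - mu) ^+ 2 <= s ^- 2 by rewrite E lerDl.
rewrite -exprVn ler_pXn2r ?nnegrE ?cabs_ge0 ?invr_ge0 ?(ltW s0)// => h.
by rewrite -ler_pdivlMr// mul1r.
Qed.

(* The pencil det(t - (z - A)^* (z - A)) shares with that of B the nonzero root
   t = 1 / ||(z - A)^-1||^2, so the difference of the two cubics in t, which has
   only t and t^2 terms, is determined by it. *)
Lemma det_gram_eq (A B : 'M[C]_3) : identical_pseudospectra A B ->
  char_poly A = char_poly B -> (forall mu, A <> mu%:M) ->
  forall z t, \det (t%:M - gram A z) = \det (t%:M - gram B z).
Proof.
move=> AB chiE nscal.
have detE z : \det (z%:M - A) = \det (z%:M - B).
  by rewrite -!horner_char_poly chiE.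
have two0 : (2 : C) != 0 by rewrite pnatr_eq0.
have detNE : \det A = \det B.
  have := detE 0; rewrite raddf0 !sub0r -(scaleN1r A) -(scaleN1r B) !detZ.
  by apply: mulfI; rewrite expf_neq0// oppr_eq0 oner_eq0.
have coefE z : z * (2 * z * (\tr A - \tr B) - ((\tr A) ^+ 2 - \tr (A *m A)
    - ((\tr B) ^+ 2 - \tr (B *m B)))) = 0.
  have := congr1 (fun x => 2 * x) (detE z); rewrite /= !det3_sub_scalar detNE.
  by move=> /eqP; rewrite -subr_eq0 => /eqP E; rewrite -[RHS]oppr0 -E; ring.
have trE : \tr A = \tr B.
  have four0 : (4 : C) != 0 by rewrite pnatr_eq0.
  (* The values at 1 and -1 separate the trace from the other coefficient. *)
  have := coefE 1; have := coefE (-1); rewrite mul1r mulN1r => /eqP.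
  rewrite oppr_eq0 => /eqP h1 h2; apply/eqP; rewrite -subr_eq0; apply/eqP.
  by apply: (mulfI four0); rewrite mulr0 -[RHS](subrr 0) -{1}h2 -h1; ring.
have trsqE : \tr (A *m A) = \tr (B *m B).
  have := coefE 1; rewrite trE => h.
  by apply/eqP; rewrite -subr_eq0 -[X in _ == X]h; apply/eqP; ring.
have [c [w [k [cJ kJ diffE]]]] := det_gram_diff trE trsqE detE.
have root_eq z : z%:M - A \in unitmx ->
    c * (z * conjc z - (opnorm (invmx (z%:M - A)) ^- 2)%:C)
    + conjc z * w + z * conjc w + k = 0.
  move=> uA; have uB := uA; rewrite (identical_unit z AB) in uB.
  have rA := resolvent_norm_gram_root uA; have rB := resolvent_norm_gram_root uB.
  rewrite -(identical_norm AB uA) in rB.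
  have s0 := opnorm_inv_gt0 uA; have := diffE z (opnorm (invmx (z%:M - A)) ^- 2)%:C.
  rewrite rA rB subrr => /esym/eqP; rewrite mulf_eq0 => /orP[|/eqP//].
  rewrite -(rmorph0 (real_complex R)) (inj_eq (@complexI R)) invr_eq0.
  by rewrite expf_eq0/= gt_eqF.
have c0 : c = 0.
  apply/eqP/negPn/negP => cn0.
  have [||mu Amu] := @resolvent_norm_quadric_scalar _ A (w / c) (k / c).
  - by rewrite rmorphM fmorphV/= cJ kJ.
  - move=> z uz; apply/eqP; rewrite -subr_eq0; apply/eqP/(mulfI cn0).
    have wcJ : conjc (w / c) = conjc w / c by rewrite rmorphM fmorphV/= cJ.
    rewrite mulr0 -[RHS]oppr0 -(root_eq z uz) wcJ.
    by move: (_ ^- 2)%:C => t; field.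
  exact: nscal Amu.
(* An affine function vanishing at infinitely many points is zero, even with the spectrum left out.
   Real [z] then gives [k] and the real part of [w], imaginary [z] the imaginary part. *)
have linear0 (a b : C) (f : nat -> C) : injective f ->
    (forall j, (f j)%:M - A \in unitmx -> f j * a + b = 0) -> a = 0 /\ b = 0.
  move=> injf h; have p0 : a *: 'X + b%:P = 0.
    apply/eqP/negPn/negP => pn0.
    have [j] := exists_nonroot (mulf_neq0 pn0 (char_poly_neq0 A)) injf.
    rewrite rootM negb_or -unit_resolvent => /andP[nr uj].
    by case/negP: nr; rewrite rootE !hornerE mulrC h.
  have := congr1 (fun p : {poly C} => p`_1) p0.
  have := congr1 (fun p : {poly C} => p`_0) p0.
  by rewrite !coefD !coefZ !coefX !coefC/= mulr0 mulr1 add0r addr0.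
have natI : injective (fun j : nat => (j%:R : C)).
  by move=> i j /eqP; rewrite eqr_nat => /eqP.
have [wwJ k0] : conjc w + w = 0 /\ k = 0.
  apply: (linear0 _ _ (fun j => j%:R)) => // j uj.
  by rewrite -(root_eq _ uj) c0 conjc_nat; ring.
have i0 : ('i : C) != 0 by apply: neq0Ci.
have iJ : conjc ('i : C) = - 'i by apply: conjCi.
have [wJ _] : conjc w - w = 0 /\ k = 0.
  apply: (linear0 _ _ (fun j => 'i * j%:R)) => [i j /(mulfI i0)/natI//|j uj].
  have zJ : conjc ('i * j%:R : C) = - ('i * j%:R).
    by rewrite rmorphM -mulNr; congr (_ * _); [apply: iJ | apply: conjc_nat].
  by rewrite -(root_eq _ uj) c0 zJ; ring.
have w0 : w = 0.
  apply: (mulfI two0); rewrite mulr0 -[RHS](subrr 0) -{1}wwJ -wJ.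
  by ring.
move=> z t; apply/eqP; rewrite -subr_eq0 diffE c0 w0 k0 rmorph0 !mulr0.
by rewrite mul0r !addr0 mulr0.
Qed.

End Cubic.

(** * Hermitian pencils, linear fractional expressions, and dimension three *)

Section Pencils.
Variable R : realType.
Local Notation C := R[i].
Local Notation "x %:C" := (real_complex R x).
#[local] Opaque opnorm vnorm.

Definition pencil n (T : 'M[C]_n) (x u y : C) : 'M[C]_n :=
  x%:M + u *: T + conjc u *: ctmx T + y *: (ctmx T *m T).

(** Completing the square in [T]; reality of [y] lets one [z] absorb both linear terms. *)
Lemma pencil_gram n (T : 'M[C]_n) (x u y z : C) : y != 0 -> conjc y = y ->
  z = - conjc (u / y) ->
  pencil T x u y = (- y) *: ((z * conjc z - x / y)%:M - gram T z).
Proof.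
move=> y0 yJ zdef; rewrite gramE /pencil.
have zJ : conjc z = - (u / y) by rewrite zdef rmorphN/= conjcK.
have zE : z = - (conjc u / y) by rewrite zdef rmorphM fmorphV/= yJ.
rewrite zJ; apply/matrixP => i j.
move: (ctmx T *m T) (ctmx T) => G T'; rewrite !mxE zE.
by case: (i == j); rewrite ?mulr1n ?mulr0n; field.
Qed.

Lemma det_pencil_eq (A B : 'M[C]_3) (x u y : C) :
  (forall z t, \det (t%:M - gram A z) = \det (t%:M - gram B z)) ->
  conjc y = y -> \det (pencil A x u y) = \det (pencil B x u y).
Proof.
move=> gE yJ; have nz y' : y' != 0 -> conjc y' = y' ->
    \det (pencil A x u y') = \det (pencil B x u y').
  move=> y0 y'J; rewrite (pencil_gram A x y0 y'J (erefl _)).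
  by rewrite (pencil_gram B x y0 y'J (erefl _)) !detZ; congr (_ * _); apply: gE.
have [->|/nz->//] := eqVneq y 0.
(* The case [y = 0] follows by interpolation: the determinant is polynomial in [y], and the two
   polynomials agree at all positive integers. *)
pose P (T : 'M[C]_3) : {poly C} := \det (map_mx polyC (pencil T x u 0) +
  'X *: map_mx polyC (ctmx T *m T)).
have PE T y' : (P T).[y'] = \det (pencil T x u y').
  rewrite /P -[_.[y']]/(horner_eval y' _) -det_map_mx; congr (\det _).
  rewrite /pencil scale0r addr0; apply/matrixP => i j.
  by rewrite !mxE/= /horner_eval hornerD hornerM hornerX !hornerC.
rewrite -!PE; suff -> : P A = P B by [].
apply/eqP; rewrite -subr_eq0; apply/negPn/negP => P0.
have injf : injective (fun k : nat => (k.+1%:R : C)).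
  by move=> i j /eqP; rewrite eqr_nat => /eqP[].
have [k] := exists_nonroot P0 injf; rewrite rootE hornerD hornerN !PE.
by rewrite nz ?subrr ?eqxx// ?pnatr_eq0// conjc_nat.
Qed.

(** Puts the matrix whose determinant decides the norm of a linear fractional expression, with
    [a = s^2], into pencil form. *)
Lemma frac_pencil n (T : 'M[C]_n) (a m1 m0 n1 n0 : C) : conjc a = a ->
  a *: (ctmx (n1 *: T + n0%:M) *m (n1 *: T + n0%:M))
    - ctmx (m1 *: T + m0%:M) *m (m1 *: T + m0%:M) =
  pencil T (a * (n0 * conjc n0) - m0 * conjc m0)
    (a * (conjc n0 * n1) - conjc m0 * m1)
    (a * (n1 * conjc n1) - m1 * conjc m1).
Proof.
move=> aJ.
have uJ : conjc (a * (conjc n0 * n1) - conjc m0 * m1) =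
    a * (n0 * conjc n1) - m0 * conjc m1.
  by rewrite rmorphB !rmorphM/= aJ !conjcK.
rewrite /pencil uJ !ctmxD !ctmxZ !ctmx_scalar !mulmxDl !mulmxDr.
rewrite -!scalemxAl -!scalemxAr !mul_scalar_mx !mul_mx_scalar.
apply/matrixP => i j.
move: (ctmx T *m T) (ctmx T) => G T'; rewrite !mxE.
by case: (i == j); rewrite ?mulr1n ?mulr0n; ring.
Qed.

Lemma linear_fractional_opnorm (A B : 'M[C]_3) (m1 m0 n1 n0 : C) :
  (forall z t, \det (t%:M - gram A z) = \det (t%:M - gram B z)) ->
  n1 *: A + n0%:M \in unitmx -> n1 *: B + n0%:M \in unitmx ->
  opnorm ((m1 *: A + m0%:M) *m invmx (n1 *: A + n0%:M)) =
  opnorm ((m1 *: B + m0%:M) *m invmx (n1 *: B + n0%:M)).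
Proof.
move=> gE uA uB; apply: (opnorm_frac_eq uA uB) => s.
have aJ : conjc ((s ^+ 2)%:C) = (s ^+ 2)%:C by apply: conjc_real.
move: (s ^+ 2)%:C aJ => a aJ.
rewrite (frac_pencil A m1 m0 n1 n0 aJ) (frac_pencil B m1 m0 n1 n0 aJ).
apply: (det_pencil_eq _ _ gE).
by rewrite rmorphB !rmorphM/= aJ !conjcK (mulrC (conjc n1)) (mulrC (conjc m1)).
Qed.

Lemma size_sub_monic n (p q : {poly C}) : p \is monic -> q \is monic ->
  size p = n.+1 -> size q = n.+1 -> (size (p - q)%R <= n)%N.
Proof.
move=> /monicP pmon /monicP qmon pn qn; apply/leq_sizeP => i; rewrite coefB.
rewrite leq_eqVlt => /orP[/eqP <-|ni]; last by rewrite !nth_default ?pn ?qn ?subrr.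
by move: pmon qmon; rewrite /lead_coef pn qn => -> ->; rewrite subrr.
Qed.

Lemma monic_size4E (p : {poly C}) : p \is monic -> size p = 4 ->
  p = 'X^3 + p`_2 *: 'X^2 + p`_1 *: 'X + (p`_0)%:P.
Proof.
move=> pmon p4; have p3 : p`_3 = 1 by move/monicP: pmon; rewrite /lead_coef p4.
apply/polyP => i; rewrite !coefD !coefZ !coefXn coefX coefC.
case: i => [|[|[|[|i]]]]/=; rewrite ?mulr0 ?mulr1 ?addr0 ?add0r ?p3//.
by rewrite nth_default// p4.
Qed.

(* Modulo chi = X^3 + c2 X^2 + c1 X + c0, multiplying X^2 + q1 X + q0 by X - b
   with b = q1 - c2 leaves a polynomial of degree at most 1. *)
Lemma quadratic_linear_fractional n (T : 'M[C]_n.+1) (chi : {poly C})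
    (q1 q0 b : C) :
  chi \is monic -> size chi = 4 -> horner_mx T chi = 0 ->
  b = q1 - chi`_2 -> T - b%:M \in unitmx ->
  T *m T + q1 *: T + q0%:M =
  ((q0 - b * q1 - chi`_1) *: T + (- b * q0 - chi`_0)%:M)
    *m invmx (1 *: T + (- b)%:M).
Proof.
move=> cmon c4 cT bE uT.
have E : ('X * 'X + q1 *: 'X + q0%:P) * ('X - b%:P) =
    (q0 - b * q1 - chi`_1) *: 'X + (- b * q0 - chi`_0)%:P + chi.
  rewrite {3}(monic_size4E cmon c4) -!mul_polyC bE.
  by rewrite !(rmorphB, rmorphM, rmorphN)/= !exprS expr0; ring.
move: (q0 - b * q1 - chi`_1) (- b * q0 - chi`_0) E => a1 a0 E.
have -> : 1 *: T + (- b)%:M = T - b%:M by rewrite scale1r raddfN.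
rewrite -[LHS](mulmxK uT); congr (_ *m _); have := congr1 (horner_mx T) E.
rewrite rmorphM rmorphB !rmorphD/= !linearZ/= rmorphM/= cT addr0.
by rewrite !horner_mx_C !horner_mx_X.
Qed.

Lemma cubic_isometric_le (A B : 'M[C]_3) (f : {poly C}) :
  char_poly A = char_poly B ->
  (forall z t, \det (t%:M - gram A z) = \det (t%:M - gram B z)) ->
  opnorm (horner_mx A f) <= opnorm (horner_mx B f).
Proof.
move=> chiE gE; set chi := char_poly A.
have cmon : chi \is monic by apply: char_poly_monic.
have c4 : size chi = 4 by apply: size_char_poly.
have cA : horner_mx A chi = 0 by apply: Cayley_Hamilton.
have cB : horner_mx B chi = 0 by rewrite /chi chiE; apply: Cayley_Hamilton.
pose r := f %% chi.
have redE (T : 'M[C]_3) : horner_mx T chi = 0 ->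
    horner_mx T f = r`_2 *: (T *m T) + r`_1 *: T + (r`_0)%:M.
  move=> cT; rewrite {1}(divp_eq f chi) rmorphD rmorphM/= cT mulr0 add0r.
  have r3 : (size r <= 3)%N.
    by have := ltn_modpN0 f (monic_neq0 cmon); rewrite c4.
  rewrite -/r {1}(poly_size3E r3) !rmorphD/= !linearZ/= rmorphXn/= horner_mx_X.
  by rewrite horner_mx_C expr2.
(* Without a quadratic term the expression is linear fractional with denominator 1. *)
rewrite (redE A cA) (redE B cB); have [->|r2] := eqVneq r`_2 0.
  rewrite !scale0r !add0r.
  have u1 (T : 'M[C]_3) : 0 *: T + 1%:M \in unitmx by rewrite scale0r add0r unitmx1.
  have := linear_fractional_opnorm r`_1 r`_0 gE (u1 A) (u1 B).
  by rewrite !scale0r !add0r invmx1 !mulmx1 => ->.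
pose q1 := r`_1 / r`_2; pose q0 := r`_0 / r`_2.
have qE (T : 'M[C]_3) : r`_2 *: (T *m T) + r`_1 *: T + (r`_0)%:M =
    r`_2 *: (T *m T + q1 *: T + q0%:M).
  rewrite !scalerDr scalerA scale_scalar_mx /q1 /q0.
  by rewrite ![r`_2 * _]mulrC !divfK.
rewrite !qE !opnormZ; apply: ler_wpM2l; first exact: cabs_ge0.
move: q1 q0 {qE redE r2} => q1 q0.
apply: opnorm_le_approx => e e0.
have [K [Kp KA KB]] : exists K, [/\ 0 < K, opnorm A <= K & opnorm B <= K].
  exists (opnorm A + opnorm B + 1).
  have := opnorm_ge0 A; have := opnorm_ge0 B.
  by move: (opnorm A) (opnorm B) => a b *; split; lra.
(* The denominator vanishes at [q1 - chi_2], possibly an eigenvalue. A nearby [b] off the spectrum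
   amounts to replacing [q1] by [b + chi_2], at a cost of at most [e] in norm. *)
have [b [bq _ nr]] :=
  exists_nonroot_near (q1 - chi`_2) (monic_neq0 cmon) (divr_gt0 e0 Kp).
have bE : b = (b + chi`_2) - chi`_2 by rewrite addrK.
have dE : b + chi`_2 - q1 = b - (q1 - chi`_2) by rewrite opprB addrA addrAC.
have small (T : 'M[C]_3) : opnorm T <= K -> opnorm ((b + chi`_2 - q1) *: T) <= e.
  move=> TK; rewrite opnormZ dE -(divfK (lt0r_neq0 Kp) e).
  by apply: ler_pM; rewrite ?cabs_ge0 ?opnorm_ge0// ltW.
have unitb (T : 'M[C]_3) : char_poly T = chi -> T - b%:M \in unitmx.
  move=> cT; have : b%:M - T \in unitmx by rewrite unit_resolvent cT.
  by rewrite -opprB -scaleN1r unitmxZ ?unitrN1.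
exists (A *m A + (b + chi`_2) *: A + q0%:M), (B *m B + (b + chi`_2) *: B + q0%:M).
split.
- rewrite -opnormN opprB; apply: le_trans (small A KA); rewrite le_eqVlt.
  apply/orP; left; apply/eqP; congr opnorm.
  by apply/matrixP => i j; rewrite !mxE; ring.
- apply: le_trans (small B KB); rewrite le_eqVlt.
  apply/orP; left; apply/eqP; congr opnorm.
  by apply/matrixP => i j; rewrite !mxE; ring.
have uA := unitb A erefl; have uB := unitb B (esym chiE).
rewrite (quadratic_linear_fractional q0 cmon c4 cA bE uA).
rewrite (quadratic_linear_fractional q0 cmon c4 cB bE uB).
have one (T : 'M[C]_3) : 1 *: T + (- b)%:M = T - b%:M by rewrite scale1r raddfN.
rewrite -(one A) in uA; rewrite -(one B) in uB.
by rewrite (linear_fractional_opnorm _ _ gE uA uB).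
Qed.

Lemma identical_isometric3 (A B : 'M[C]_3) :
  identical_pseudospectra A B -> polynomially_isometric A B.
Proof.
move=> AB; have BA := identical_pseudospectra_sym AB.
have [[p [p0 p3 pA]]|nquad] :=
    pselect (exists p : {poly C},
      [/\ p != 0, (size p <= 3)%N & horner_mx A p = 0]).
  exact: quadratic_isometric AB p0 p3 pA.
have chiE : char_poly A = char_poly B.
  (* Both characteristic polynomials annihilate [A] and are monic cubics, so a nonzero difference
     would be an annihilator of degree at most two. *)
  apply/eqP; rewrite -subr_eq0; apply/negPn/negP => d0; apply: nquad.
  exists (char_poly A - char_poly B); split=> //; last first.
    rewrite rmorphB/= Cayley_Hamilton.
    by rewrite (identical_annihilator BA (Cayley_Hamilton B)) subr0.
  exact: size_sub_monic (char_poly_monic _) (char_poly_monic _)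
    (size_char_poly _) (size_char_poly _).
have nscal mu : A <> mu%:M.
  move=> Amu; apply: nquad; exists ('X - mu%:P).
  rewrite polyXsubC_eq0 size_XsubC; split=> //.
  by rewrite rmorphB/= horner_mx_X horner_mx_C Amu subrr.
have gE := det_gram_eq AB chiE nscal.
move=> f; rewrite !pevalE; apply/eqP; rewrite eq_le; apply/andP; split.
  exact: cubic_isometric_le chiE gE.
by apply: (cubic_isometric_le _ (esym chiE)) => z t; apply: esym (gE z t).
Qed.

End Pencils.

Theorem theorem1 (R : realType) (d : nat) (hd : d = 2%N \/ d = 3%N)
  (A B : 'M[R[i]]_d) :
  identical_pseudospectra A B <-> polynomially_isometric A B.
Proof.
case: hd A B => -> A B; split; try exact: polynomially_isometric_identical.
  move=> AB.
  (* In dimension two the characteristic polynomial is the quadratic annihilator. *)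
  apply: quadratic_isometric AB (char_poly_neq0 A) _ (Cayley_Hamilton A).
  by rewrite size_char_poly.
exact: identical_isometric3.
Qed.
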